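(* For every $d\in\mathbb{N}$ there exists $\mathsf{C}_d\in(0,\infty)$ such that for all integers $n\ge k\ge d$, every function $f:\{-1,1\}^n\to\mathbb{R}$ of degree at most $d$ satisfies $$\inf_{g\in \mathscr{P}_{>k}^n} \|f-g\|_1 \leq \mathsf{K} \big( \widehat{f}, \mathsf{C}_d k^d; \ell_2^m, \ell_{\frac{2d}{d-1}}^m\big),$$ where $\widehat f=(\widehat f(S))_{|S|\le d}$ is the vector of Fourier coefficients of $f$, viewed as an element of $\mathbb{R}^m$ with $m=\binom n0+\cdots+\binom nd$, and $\ell_{\frac{2d}{d-1}}^m$ is interpreted as $\ell_\infty^m$ when $d=1$.
   Context: Every $f:\{-1,1\}^n\to\mathbb{R}$ has a unique Fourier–Walsh expansion $f=\sum_{S\subseteq\{1,\dots,n\}}\widehat f(S)w_S$, where $w_S(x)=\prod_{i\in S}x_i$; $f$ has degree at most $d$ if $\widehat f(S)=0$ whenever $|S|>d$. $\mathscr{P}^n_{>k}=\{g:\{-1,1\}^n\to\mathbb{R}:\ \widehat g(S)=0 \text{ whenever } |S|\le k\}$. $\|\cdot\|_1$ is the $L_1$ norm with respect to the uniform probability measure on $\{-1,1\}^n$. For normed spaces $A_0,A_1$ on $\mathbb{R}^m$, $t\ge0$ and $a\in\mathbb{R}^m$, the $\mathsf{K}$-functional is $\mathsf{K}(a,t;A_0,A_1)=\inf\{\|a_0\|_{A_0}+t\|a_1\|_{A_1}:\ a=a_0+a_1\}$. *)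

(* Defs.v *)
From HB Require Import structures.
From mathcomp Require Import all_boot all_order all_algebra.
From mathcomp Require Import boolp classical_sets reals exp.
Set Implicit Arguments. Unset Strict Implicit. Unset Printing Implicit Defensive.
Import Order.TTheory GRing.Theory Num.Theory.
Local Open Scope ring_scope.
Local Open Scope classical_set_scope.

(* The discrete cube {-1,1}^n: x i = true encodes x_i = 1, false encodes -1. *)
Definition cube (n : nat) : finType := {ffun 'I_n -> bool}.

Section Defs.
Variable R : realType.
Variable n : nat.

Definition spin (b : bool) : R := if b then 1 else -1.

Definition walsh (S : {set 'I_n}) (x : cube n) : R := \prod_(i in S) spin (x i).

Definition fhat (f : cube n -> R) (S : {set 'I_n}) : R :=
  ((2 : R) ^+ n)^-1 * \sum_(x : cube n) f x * walsh S x.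

Definition deg_le (f : cube n -> R) (d : nat) : Prop :=
  forall S : {set 'I_n}, (d < #|S|)%N -> fhat f S = 0.

Definition Pgt (k : nat) (g : cube n -> R) : Prop :=
  forall S : {set 'I_n}, (#|S| <= k)%N -> fhat g S = 0.

Definition L1norm (f : cube n -> R) : R :=
  ((2 : R) ^+ n)^-1 * \sum_(x : cube n) `|f x|.

(* Vectors in R^m, m = sum_{j<=d} C(n,j), are indexed by {S : #|S| <= d};
   a : {set 'I_n} -> R, values outside the index set are ignored. *)
Definition ell2 (d : nat) (a : {set 'I_n} -> R) : R :=
  Num.sqrt (\sum_(S : {set 'I_n} | (#|S| <= d)%N) a S ^+ 2).

Definition qexp (d : nat) : R := (2 * d%:R) / (d%:R - 1).

Definition ellq (d : nat) (a : {set 'I_n} -> R) : R :=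
  if d == 1%N then \big[Num.max/0]_(S : {set 'I_n} | (#|S| <= d)%N) `|a S|
  else (\sum_(S : {set 'I_n} | (#|S| <= d)%N) `|a S| `^ qexp d) `^ (qexp d)^-1.

Definition Kfun (d : nat) (a : {set 'I_n} -> R) (t : R) : R :=
  inf [set v : R | exists a0 a1 : {set 'I_n} -> R,
         (forall S : {set 'I_n}, (#|S| <= d)%N -> a S = a0 S + a1 S) /\
         v = ell2 d a0 + t * ellq d a1].

Definition distPgt (k : nat) (f : cube n -> R) : R :=
  inf [set L1norm (fun x => f x - g x) | g in Pgt k].

End Defs.

(* Main.v *)
(** By duality (Hahn-Banach on the finite-dimensional space of functions on the
    cube), the distance from f to P_{>k} in L_1 equals E[f h] for some h of degree
    at most k with |h| <= 1.  Write c for the Fourier coefficients of h on the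
    levels at most d; then E[f h] = sum_S fhat f S * c S.  The l_2 part of fhat f
    is paired with c by Cauchy-Schwarz and Parseval, so it remains to show that c
    is bounded by C_d k^d in the dual norm l_{2d/(d+1)}.

    - A polynomial of degree k bounded by 1 on [-1,1] has derivative at most 5k at
      0 (averaging against the Fejer kernel on the circle); iterating on shrinking
      intervals, its coefficients of order at most d are O_d(k^d).  Applied to
      t |-> h(t x), this bounds the truncation g of h to the levels at most d.
    - The same estimate applied to t |-> g((x + t y)/2), for y the sign vector of
      the gradient, bounds sum_i |d_i g(x/2)| uniformly in x.  By hypercontractivity
      L_1 and L_2 norms of d_i g are comparable, whence
      sum_i b_i = O_d(k^d) for b_i = (sum_(S containing i) c_S^2)^(1/2).
    - After normalising sum_i b_i <= 1, each term obeys
      |a_S c_S| <= |a_S|^q + c_S^2 sum_(i in S) 1/b_i + prod_(i in S) b_i with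
      q = 2d/(d-1), and the three sums over S are bounded by constants. *)
Require Import Defs.
From mathcomp Require Import all_boot all_order all_algebra.
From mathcomp Require Import cyclic separable cyclotomic complex.
From mathcomp Require Import boolp classical_sets reals exp.
From mathcomp Require Import sequences ring lra.
Set Implicit Arguments. Unset Strict Implicit. Unset Printing Implicit Defensive.
Import Order.TTheory GRing.Theory Num.Theory.
Local Open Scope ring_scope.

(** * Fejer averaging over roots of unity and a Bernstein inequality on the circle *)

Lemma numClosed_prim_root (C : numClosedFieldType) (N : nat) :
  (0 < N)%N -> exists w : C, N.-primitive_root w.
Proof.
move=> N_gt0.
have [rs] := closed_field_poly_normal ('X^N - 1 : {poly C}).
rewrite (monicP _) ?monicXnsubC// scale1r => Drs.
have /hasP[w _ w_prim] : has N.-primitive_root rs; last by exists w.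
apply: has_prim_root => //.
- by apply/allP => z; rewrite -root_prod_XsubC -Drs.
- by rewrite -separable_prod_XsubC -Drs separable_Xn_sub_1// pnatr_eq0 -lt0n.
- by rewrite -ltnS -(size_prod_XsubC rs id) -Drs size_XnsubC.
Qed.

Lemma norm_prim_root (C : numClosedFieldType) (N : nat) (w : C) :
  N.-primitive_root w -> `|w| = 1.
Proof.
move=> hw; apply/eqP.
rewrite -(@pexpr_eq1 _ _ N) ?(prim_order_gt0 hw)//.
by rewrite -normrX (prim_expr_order hw) normr1.
Qed.

Lemma sum_unity_root (F : fieldType) (N : nat) (x : F) : x ^+ N = 1 ->
  \sum_(m < N) x ^+ m = if x == 1 then N%:R else 0.
Proof.
move=> xN; case: eqP => [->|/eqP x1].
  by rewrite (eq_bigr (fun=> 1)) ?sumr_const ?card_ord// => i _; rewrite expr1n.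
have := subrX1 x N; rewrite xN subrr => /esym/eqP.
by rewrite mulf_eq0 subr_eq0 (negPf x1) => /eqP.
Qed.

(** Each b < n - l has the single partner a = b + l, other b have none. The count is the l-th
    Fourier coefficient of the Fejer kernel |sum_(a < n) z^a|^2. *)
Lemma count_diff (n l : nat) : (l <= n)%N ->
  (\sum_(b < n) \sum_(a < n) (b + l == a) = n - l)%N.
Proof.
move=> ln; rewrite -[RHS]card_ord -sum1_card.
rewrite (big_ord_widen _ (fun=> 1%N) (leq_subr l n)) [RHS]big_mkcond/=.
apply: eq_bigr => b _; rewrite ltn_subRL addnC.
case: ltnP => h.
  rewrite (bigD1 (Ordinal h))//= addnC eqxx big1// => a.
  by apply: contraNeq; rewrite eqb0 negbK -val_eqE/= addnC eq_sym.
rewrite big1// => a _; apply/eqP; rewrite eqb0; apply/eqP => ha.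
by move: (ltn_ord a); rewrite -ha ltnNge => /negP; apply.
Qed.

Lemma fejer_moment (C : numClosedFieldType) (n l : nat) (w : C) :
  (2 * n).-primitive_root w -> (l <= n)%N ->
  \sum_(m < 2 * n) `|\sum_(a < n) (w ^+ m) ^+ a| ^+ 2 * (w ^+ m) ^+ l
    = (2 * n)%:R * (n - l)%:R.
Proof.
move=> hw ln; have nw := norm_prim_root hw.
have wN := prim_expr_order hw.
have ww : w * w^* = 1 by rewrite -normCK nw expr1n.
transitivity (\sum_(b < n) \sum_(a < n)
    \sum_(m < 2 * n) (w ^+ (b + l) * w^* ^+ a) ^+ m).
  rewrite [RHS](eq_bigr (fun b : 'I_n => \sum_(m < 2 * n) \sum_(a < n)
    (w ^+ (b + l) * w^* ^+ a) ^+ m)); last by move=> b _; rewrite exchange_big.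
  rewrite [RHS]exchange_big; apply: eq_bigr => m _ /=.
  rewrite normCK mulrAC mulr_suml mulr_suml; apply: eq_bigr => b _.
  rewrite rmorph_sum mulr_sumr; apply: eq_bigr => a _ /=.
  by rewrite !rmorphXn exprMn -exprD -!exprM mulnC [(a * m)%N]mulnC.
rewrite -natrM mulnC -count_diff// mulnC natrM natr_sum mulr_sumr.
apply: eq_bigr => b _; rewrite natr_sum mulr_sumr; apply: eq_bigr => a _.
rewrite sum_unity_root; last first.
  rewrite exprMn exprAC wN [X in _ * X]exprAC -rmorphXn wN.
  by rewrite rmorph1 !expr1n mulr1.
(* As l <= n, both b + l and a lie in [0, 2n), so congruence modulo 2n is equality; hence the choice
   of 2n nodes. *)
have -> : (w ^+ (b + l) * w^* ^+ a == 1) = (b + l == a)%N.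
  have wa : w ^+ a * w^* ^+ a = 1 by rewrite -exprMn ww expr1n.
  have wa0 : w^* ^+ a != 0.
    by apply/eqP => h; move/eqP: wa; rewrite h mulr0 eq_sym oner_eq0.
  rewrite -[X in _ == X]wa (inj_eq (mulIf wa0)) (eq_prim_root_expr hw).
  rewrite !modn_small//.
    by rewrite (leq_trans (ltn_ord a))// leq_pmull.
  by rewrite mul2n -addnn -addSn leq_add.
by case: eqP; rewrite ?mulr1 ?mulr0.
Qed.

(* The weights n - l, 0 <= l <= n, are the Fourier coefficients of the Fejer
   kernel, which is positive; hence sum_l (n - l) q_l is an average of values
   of Q on the circle, and so is Q'(1) = n Q(1) - sum_l (n - l) q_l. *)
Lemma bernstein_unit_circle (C : numClosedFieldType) (n : nat) (Q : {poly C}) (M : C) :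
  (0 < n)%N -> (size Q <= n.+1)%N -> (forall z, `|z| = 1 -> `|Q.[z]| <= M) ->
  `|Q^`().[1]| <= 2 * n%:R * M.
Proof.
move=> n0 sQ QM.
have N0 : (0 < 2 * n)%N by rewrite muln_gt0.
have [w hw] := numClosed_prim_root C N0; have nw := norm_prim_root hw.
pose D m := \sum_(a < n) (w ^+ m) ^+ a.
have Navg : (2 * n)%:R * (\sum_(l < n.+1) (n - l)%:R * Q`_l) =
    \sum_(m < 2 * n) `|D m| ^+ 2 * Q.[w ^+ m].
  rewrite mulr_sumr; under [RHS]eq_bigr do rewrite (horner_coef_wide _ sQ) mulr_sumr.
  rewrite exchange_big; apply: eq_bigr => l _ /=.
  have ln : (l <= n)%N by rewrite -ltnS.
  rewrite mulrA -(fejer_moment hw ln) mulr_suml.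
  by apply: eq_bigr => m _; rewrite /D mulrCA mulrC.
have Npos : 0 < (2 * n)%:R :> C by rewrite ltr0n.
have avg_le : `|\sum_(l < n.+1) (n - l)%:R * Q`_l| <= n%:R * M.
  rewrite -(ler_pM2l Npos) -{1}[(2 * n)%:R]ger0_norm ?ler0n// -normrM Navg.
  apply: le_trans (ler_norm_sum _ _ _) _.
  have := fejer_moment hw (leq0n n); rewrite subn0 mulrA => <-; rewrite mulr_suml.
  apply: ler_sum => m _; rewrite expr0 mulr1 normrM ger0_norm ?exprn_ge0//.
  by rewrite ler_wpM2l ?exprn_ge0// QM// normrX nw expr1n.
have -> : Q^`().[1] = n%:R * Q.[1] - \sum_(l < n.+1) (n - l)%:R * Q`_l.
  rewrite (horner_coef_wide _ sQ) mulr_sumr -sumrB.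
  have sQ' : (size Q^`() <= n)%N.
    by apply: leq_trans (size_poly _ _) _; case: (size Q) sQ.
  rewrite (horner_coef_wide _ sQ') big_ord_recl/= expr1n subn0 mulr1 subrr add0r.
  apply: eq_bigr => l _; rewrite coef_deriv !expr1n !mulr1 /bump/= add1n.
  by rewrite -mulrBl -natrB ?leq_subr// subKn ?ltn_ord// mulr_natl.
apply: le_trans (ler_normB _ _) _.
have -> : 2 * n%:R * M = n%:R * M + n%:R * M by ring.
rewrite lerD// normrM ger0_norm ?ler0n//.
by rewrite ler_wpM2l// QM// normr1.
Qed.

(** * Coefficients of polynomials bounded on [-1,1] *)

Lemma size_exp_le (R : idomainType) (p : {poly R}) (m j : nat) :
  (size p <= m.+1)%N -> (size (p ^+ j) <= (m * j).+1)%N.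
Proof.
move=> sp; apply: leq_trans (size_poly_exp_leq _ _) _.
by rewrite ltnS leq_mul2r; case: (size p) sp => [|s]/= sp; rewrite ?orbT// -ltnS sp orbT.
Qed.

Lemma norm_real_complex (R : rcfType) (x : R) : `|x%:C%C| = `|x|%:C%C.
Proof. by rewrite normc_def /= expr0n addr0 sqrtr_sqr. Qed.

Section Sine.
Variables (R : rcfType) (k : nat) (p : {poly R}).
Hypothesis sp : (size p <= k.+1)%N.

(** Equals z Im z on the unit circle, because z^2 - 1 = z (z - conj z) = 2i z Im z there. *)
Let A : {poly R[i]} := ('X^2 - 1) * (- ('i / 2))%:P.

(* sinpoly(e^(i t)) = e^(i k t) p(sin t) *)
Definition sinpoly : {poly R[i]} :=
  \sum_(j < k.+1) (p`_j)%:C%C%:P * A ^+ j * 'X^(k - j).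

Let iC2 : 'i * 'i = -1 :> R[i].
Proof. by rewrite -expr2 sqrCi. Qed.

Lemma size_sinpoly : (size sinpoly <= (2 * k).+1)%N.
Proof.
have sA : (size A <= 3)%N.
  apply: leq_trans (size_polyMleq _ _) _; rewrite size_XnsubC//.
  by apply: leq_trans (leq_add (leqnn 2) (size_polyC_leq1 _)) _.
apply: leq_trans (size_sum _ _ _) _; apply/bigmax_leqP => j _.
apply: leq_trans (size_polyMleq _ _) _; rewrite size_polyXn addnS/=.
apply: leq_trans (leq_add (size_polyMleq _ _) (leqnn _)) _.
have h1 : (size (p`_j)%:C%C%:P <= 1)%N by exact: size_polyC_leq1.
have h2 := @size_exp_le _ A 2 j sA.
have jk : (j <= k)%N by rewrite -ltnS.
move: h1 h2; set u := size _; set v := size _ => h1 h2.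
have : ((u + v).-1 <= (2 * j).+1)%N.
  by rewrite -subn1 leq_subLR (leq_trans (leq_add h1 h2)).
move=> h; apply: leq_trans (leq_add h (leqnn _)) _.
by rewrite addSn ltnS mul2n -addnn -addnA subnKC// mul2n -addnn leq_add2r.
Qed.

Lemma horner_sinpoly (z : R[i]) : `|z| = 1 ->
  sinpoly.[z] = z ^+ k * (p.[complex.Im z])%:C%C.
Proof.
move=> nz; have Az : A.[z] = z * (complex.Im z)%:C%C.
  rewrite !hornerE.
  have -> : z ^+ 2 - 1 = z * (z - z^*%C).
    by rewrite mulrBr -sqr_normc nz expr1n expr2.
  rewrite subcJ complexiE; set y := (complex.Im z)%:C%C.
  transitivity (z * y * - ('i * 'i)); last by rewrite iC2 opprK mulr1.
  by field.
rewrite horner_sum (horner_coef_wide _ sp) rmorph_sum mulr_sumr.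
apply: eq_bigr => j _; have jk : (j <= k)%N by rewrite -ltnS.
rewrite 2!hornerM hornerC horner_exp Az hornerXn exprMn rmorphM rmorphXn /=.
have -> : z ^+ k = z ^+ j * z ^+ (k - j) by rewrite -exprD subnKC.
by ring.
Qed.

(** [A] vanishes at 1 with derivative -i, so only the terms j = 0 and j = 1 contribute. The point z
    = 1 corresponds to sin t = 0, which is how p'(0) is read off on the circle. *)
Lemma deriv_sinpoly : sinpoly^`().[1] = k%:R * (p`_0)%:C%C - 'i * (p`_1)%:C%C.
Proof.
have A1 : A.[1] = 0 by rewrite !hornerE expr1n subrr mul0r.
have A'1 : A^`().[1] = - 'i.
  rewrite derivM derivC mulr0 addr0 derivB derivXn derivC subr0 !hornerE.
  by field.
have term j : (((p`_j)%:C%C%:P * A ^+ j * 'X^(k - j))^`()).[1] =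
    (p`_j)%:C%C * ((j == 0)%:R * (k - j)%:R - (j == 1)%:R * 'i) :> R[i].
  move: A1 A'1; generalize A => B B1 B'1.
  rewrite !derivM derivC mul0r add0r derivXn deriv_exp !hornerE !hornerMn.
  rewrite !hornerE !expr1n B1 B'1 !mulr1.
  case: j => [|[|j]]; rewrite /= ?expr0 ?mulr0n ?expr1 ?mulr1n ?expr0n /=; ring.
rewrite /sinpoly raddf_sum horner_sum; under eq_bigr do rewrite term.
rewrite big_ord_recl /= subn0 mulr1n mul1r mul0r subr0 mulrC; congr (_ + _).
have [k0|k0] := posnP k.
  by subst k; rewrite big_ord0 nth_default ?mulr0 ?oppr0.
case: k k0 sp => // k' _ sp'; rewrite big_ord_recl /= big1 => [|j _].
  by rewrite mul0r mul1r sub0r addr0 mulrN mulrC.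
by rewrite /= !mul0r subr0 mulr0.
Qed.

End Sine.

(** The factor 5 is 4 + 1: [sinpoly] has degree at most 2k, so the circle estimate gives 4 k M, and
    isolating p_1 in [deriv_sinpoly] costs k |p_0| <= k M. *)
Lemma markov_coef1 (R : rcfType) (k : nat) (p : {poly R}) (M : R) :
  (size p <= k.+1)%N -> (forall t, `|t| <= 1 -> `|p.[t]| <= M) ->
  `|p`_1| <= 5 * k%:R * M.
Proof.
move=> sp pM; have M0 : 0 <= M by apply: le_trans (pM 0 _); rewrite ?normr0.
have [k0|k0] := posnP k.
  by rewrite nth_default ?normr0 ?mulr_ge0 ?ler0n// (leq_trans sp) ?k0.
have p0M : `|p`_0| <= M by rewrite -horner_coef0 pM ?normr0.
have Q1 : forall z : R[i], `|z| = 1 -> `|(sinpoly k p).[z]| <= M%:C%C.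
  move=> z z1; rewrite horner_sinpoly// normrM normrX z1 expr1n mul1r.
  rewrite norm_real_complex lecR pM//.
  rewrite -(@expr_le1 _ 2)// real_normK ?num_real//.
  rewrite -lecR -[X in _ <= X](_ : `|z| ^+ 2 = _); last by rewrite z1 expr1n.
  by rewrite -add_Re2_Im2 lecR lerDr sqr_ge0.
have k20 : (0 < 2 * k)%N by rewrite muln_gt0.
have := bernstein_unit_circle k20 (size_sinpoly k p) Q1.
rewrite deriv_sinpoly// => h.
have : `|'i * (p`_1)%:C%C : R[i]| <= (5 * k%:R * M)%:C%C.
  have -> : 'i * (p`_1)%:C%C = k%:R * (p`_0)%:C%C -
    (k%:R * (p`_0)%:C%C - 'i * (p`_1)%:C%C) :> R[i] by ring.
  apply: le_trans (ler_normB _ _) _.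
  apply: le_trans (lerD (lexx _) h) _.
  rewrite normrM norm_real_complex ger0_norm ?ler0n//.
  have -> : (5 * k%:R * M)%:C%C = k%:R * M%:C%C + 2 * (2 * k)%:R * M%:C%C :> R[i].
    by rewrite !rmorphM/= !rmorph_nat natrM; ring.
  by rewrite lerD2r ler_wpM2l ?ler0n// lecR.
by rewrite normrM normCi mul1r norm_real_complex lecR.
Qed.

(** Induction on j: the interval of radius r = 2^-(j+1) around t stays within radius 2^-j of 0, so
    [markov_coef1] applies to s |-> p^(j)(t + r s). Undoing the scaling costs 1/r. *)
Lemma markov_derivn (R : rcfType) (k j : nat) (p : {poly R}) (M : R) :
  (size p <= k.+1)%N -> (forall t, `|t| <= 1 -> `|p.[t]| <= M) ->
  forall t, `|t| <= 2 ^- j -> `|p^`(j).[t]| <= (5 * 2 ^+ j * k%:R) ^+ j * M.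
Proof.
move=> sp pM; have M0 : 0 <= M by apply: le_trans (pM 0 _); rewrite ?normr0.
elim: j => [|j IH] t; first by rewrite expr0 invr1 mul1r; exact: pM.
move=> tj; set r := 2 ^- j.+1 : R in tj *.
have r0 : 0 < r by rewrite invr_gt0 exprn_gt0.
have r2 : 2 ^- j = r + r :> R.
  by rewrite /r exprS invfM -mulrDl (_ : 2^-1 + 2^-1 = 1) ?mul1r//; field.
pose q : {poly R} := p^`(j) \Po (t%:P + r *: 'X).
have sq : (size q <= k.+1)%N.
  rewrite (leq_trans (size_comp_poly_leq _ _))//.
  have : (size (t%:P + r *: 'X)%R <= 2)%N.
    rewrite (leq_trans (size_polyD _ _))// geq_max.
    rewrite (leq_trans (size_polyC_leq1 _))// (leq_trans (size_scale_leq _ _))//.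
    by rewrite size_polyX.
  have : (size p^`(j) <= k.+1)%N.
    elim: (j) => // m; rewrite derivnS; apply: leq_trans.
    by apply: leq_trans (size_poly _ _) (leq_pred _).
  case: (size p^`(j)) => [|a]// ak; case: (size (t%:P + r *: 'X)%R) => [|[|[|b]]]// _ /=;
    by rewrite ?muln0 ?muln1.
have qM s : `|s| <= 1 -> `|q.[s]| <= (5 * 2 ^+ j * k%:R) ^+ j * M.
  move=> s1; rewrite horner_comp !hornerE IH// r2.
  apply: le_trans (ler_normD _ _) _; rewrite lerD// normrM (gtr0_norm r0).
  by rewrite ler_piMr// ltW.
have := markov_coef1 sq qM.
have -> : q`_1 = r * p^`(j.+1).[t].
  have -> : q`_1 = q^`().[0] by rewrite horner_coef0 coef_deriv.
  rewrite deriv_comp hornerM horner_comp !hornerE derivD derivC derivZ derivX !hornerE.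
  by rewrite /= mulr1 mulrC.
rewrite normrM (gtr0_norm r0) -ler_pdivlMl// /r invrK => h; apply: le_trans h _.
set a := 2 ^+ j.+1.
have a0 : 0 <= a by rewrite exprn_ge0.
have -> : (5 * a * k%:R) ^+ j.+1 * M = a * (5 * k%:R * ((5 * a * k%:R) ^+ j * M)).
  by rewrite exprS; ring.
rewrite 2?ler_wpM2l ?mulr_ge0 ?ler0n// ler_wpM2r//.
rewrite lerXn2r ?nnegrE ?mulr_ge0 ?ler0n ?exprn_ge0//.
by rewrite ler_wpM2r ?ler0n// ler_wpM2l// ler_eXn2l ?ltr1n.
Qed.

(** The coefficient is p^(j)(0) / j!, and j! >= 1 is discarded. For k > 0 the base is at least 1, so
    the exponent j may be raised to d. *)
Lemma markov_coef (R : rcfType) (d k j : nat) (p : {poly R}) (M : R) :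
  (0 < k)%N -> (size p <= k.+1)%N -> (forall t, `|t| <= 1 -> `|p.[t]| <= M) ->
  (j <= d)%N -> `|p`_j| <= (5 * 2 ^+ d * k%:R) ^+ d * M.
Proof.
move=> k0 sp pM jd; have M0 : 0 <= M by apply: le_trans (pM 0 _); rewrite ?normr0.
have : `|p^`(j).[0]| <= (5 * 2 ^+ j * k%:R) ^+ j * M.
  by apply: markov_derivn; rewrite // normr0 invr_ge0 exprn_ge0.
rewrite nderivn_def hornerMn horner_coef0 coef_nderivn addn0 binn mulr1n normrMn => h.
have k1 : 1 <= k%:R :> R by rewrite ler1n.
have one m : 1 <= 5 * 2 ^+ m * k%:R :> R.
  by rewrite !mulr_ege1// ?ler1n// exprn_ege1// ler1n.
apply: le_trans (_ : _ <= (5 * 2 ^+ j * k%:R) ^+ j * M) _.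
  by apply: le_trans h; rewrite -mulr_natr ler_peMr// ler1n fact_gt0.
rewrite ler_wpM2r//; apply: le_trans (_ : _ <= (5 * 2 ^+ d * k%:R) ^+ j) _.
  rewrite lerXn2r ?nnegrE ?mulr_ge0 ?ler0n ?exprn_ge0//.
  by rewrite ler_wpM2r ?ler0n// ler_wpM2l// ler_eXn2l ?ltr1n.
by rewrite ler_weXn2l.
Qed.

(** * Fourier-Walsh analysis on the cube *)

Section Cube.
Variables (R : realType) (n : nat).
Implicit Types (x y : cube n) (S T : {set 'I_n}) (c e : {set 'I_n} -> R).

Definition mean (F : cube n -> R) : R := ((2 : R) ^+ n)^-1 * \sum_x F x.

Definition wsum c x : R := \sum_S c S * walsh R S x.

Lemma pow2n_gt0 : 0 < (2 : R) ^+ n. Proof. exact: exprn_gt0. Qed.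

Lemma meanD (F G : cube n -> R) : mean (fun x => F x + G x) = mean F + mean G.
Proof. by rewrite /mean big_split mulrDr. Qed.

Lemma meanZ (a : R) (F : cube n -> R) : mean (fun x => a * F x) = a * mean F.
Proof. by rewrite /mean -mulr_sumr mulrCA. Qed.

Lemma mean_const (a : R) : mean (fun=> a) = a.
Proof.
rewrite /mean sumr_const card_ffun card_bool card_ord -[a *+ _]mulr_natl natrX mulrA.
by rewrite mulVf ?mul1r// gt_eqF// pow2n_gt0.
Qed.

Lemma mean_le (F G : cube n -> R) : (forall x, F x <= G x) -> mean F <= mean G.
Proof.
by move=> FG; rewrite /mean ler_pM2l ?invr_gt0 ?pow2n_gt0// ler_sum.
Qed.

Lemma mean_ge0 (F : cube n -> R) : (forall x, 0 <= F x) -> 0 <= mean F.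
Proof. by move=> F0; rewrite -(mean_const 0) mean_le. Qed.

Lemma eq_mean (F G : cube n -> R) : F =1 G -> mean F = mean G.
Proof. by move=> FG; rewrite /mean (eq_bigr _ (fun x _ => FG x)). Qed.

Lemma spin_sqr (b : bool) : spin R b * spin R b = 1.
Proof. by case: b; rewrite /spin ?mulrNN mulr1. Qed.

Lemma walshE S x : walsh R S x = \prod_i (if i \in S then spin R (x i) else 1).
Proof. by rewrite /walsh big_mkcond. Qed.

Lemma sum_cube_prod (g : 'I_n -> bool -> R) :
  \sum_(x : cube n) \prod_i g i (x i) = \prod_i (g i true + g i false).
Proof.
rewrite -bigA_distr_bigA; apply: eq_bigr => i _.
by rewrite big_bool.
Qed.

Lemma walsh_ortho S T : \sum_x walsh R S x * walsh R T x = 2 ^+ n * (S == T)%:R.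
Proof.
under eq_bigr do rewrite !walshE -big_split/=.
rewrite (sum_cube_prod (fun i b => (if i \in S then spin R b else 1) *
  (if i \in T then spin R b else 1))).
have [<-|/eqP/setP ST] := eqVneq S T.
  rewrite mulr1 -[in RHS](card_ord n) -prodr_const; apply: eq_bigr => i _.
  by case: ifP => _; rewrite ?spin_sqr ?mulr1.
have [i iST] : exists i, (i \in S) != (i \in T).
  apply/existsP; apply: contraT; rewrite negb_exists => /forallP h.
  by case: ST => i; apply/eqP; have := h i; rewrite negbK.
rewrite mulr0 (bigD1 i)//= [X in X * _](_ : _ = 0) ?mul0r//.
move: iST; case: (i \in S); case: (i \in T) => //= _; rewrite ?mulr1 ?mul1r; exact: subrr.
Qed.

(** The sum over S factors as prod_i (x_i y_i + 1), and a coordinate where x and y differ kills it.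
    This dual orthogonality gives Fourier inversion. *)
Lemma walsh_complete x y : \sum_S walsh R S x * walsh R S y = 2 ^+ n * (x == y)%:R.
Proof.
transitivity (\prod_i (spin R (x i) * spin R (y i) + 1)).
  rewrite bigA_distr; apply: eq_big => [S|S _]; first by rewrite inE.
  rewrite !walshE -big_split; apply: eq_bigr => i _ /=.
  by case: ifP; rewrite ?mulr1.
have [<-|xy] := eqVneq x y.
  rewrite mulr1 -[in RHS](card_ord n) -prodr_const; apply: eq_bigr => i _.
  by rewrite spin_sqr.
have [i ixy] : exists i, x i != y i.
  apply/existsP; apply: contraNT xy; rewrite negb_exists => /forallP h.
  by apply/eqP/ffunP => i; apply/eqP; have := h i; rewrite negbK.
rewrite mulr0 (bigD1 i)//= [X in X * _](_ : _ = 0) ?mul0r//.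
by move: ixy; case: (x i); case: (y i) => //= _; rewrite ?mulr1 ?mul1r addNr.
Qed.

Lemma wsum_fhat (f : cube n -> R) x : wsum (fhat f) x = f x.
Proof.
rewrite /wsum; under eq_bigr do rewrite /fhat -mulrA mulr_suml.
rewrite -mulr_sumr exchange_big/=.
under eq_bigr => y _.
  under eq_bigr do rewrite -mulrA; rewrite -mulr_sumr walsh_complete; over.
rewrite (bigD1 x)//= eqxx mulr1 big1 => [|y yx]; last by rewrite (negPf yx) !mulr0.
by rewrite addr0 mulrCA mulVf ?mulr1// gt_eqF// pow2n_gt0.
Qed.

Lemma mean_wsumM c e : mean (fun x => wsum c x * wsum e x) = \sum_S c S * e S.
Proof.
rewrite /mean /wsum.
under eq_bigr do rewrite mulr_suml; rewrite exchange_big/= mulr_sumr.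
apply: eq_bigr => S _.
under eq_bigr do rewrite mulr_sumr; rewrite exchange_big/=.
under eq_bigr => T _.
  under eq_bigr do rewrite mulrACA; rewrite -mulr_sumr walsh_ortho; over.
rewrite (bigD1 S)//= eqxx mulr1 big1 => [|T TS]; last by rewrite eq_sym (negPf TS) !mulr0.
by rewrite addr0 mulrCA mulVf ?mulr1// gt_eqF// pow2n_gt0.
Qed.

Lemma sum_setU1 (i : 'I_n) (F : {set 'I_n} -> R) :
  \sum_(S : {set 'I_n} | i \in S) F S = \sum_(S : {set 'I_n} | i \notin S) F (i |: S).
Proof.
rewrite (reindex_onto (fun S => i |: S) (fun S => S :\ i)) => [|S iS];
  last exact: finset.setD1K.
apply: eq_bigl => S; rewrite setU11/=; apply/eqP/idP => [<-|iS].
  by rewrite !inE eqxx.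
exact: finset.setU1K.
Qed.

Definition flip (i : 'I_n) x : cube n := [ffun j => if j == i then ~~ x j else x j].

Lemma flipK i : involutive (flip i).
Proof.
by move=> x; apply/ffunP => j; rewrite !ffunE; case: (j == i); rewrite ?negbK.
Qed.

(** Flipping coordinate i preserves the uniform measure and changes the sign of the integrand, so
    the mean equals its own opposite. *)
Lemma mean_spin_flip i (F : cube n -> R) : (forall x, F (flip i x) = F x) ->
  mean (fun x => spin R (x i) * F x) = 0.
Proof.
move=> Fi; apply/eqP; rewrite -[_ == 0](mulrn_eq0 _ 2) mulr2n; apply/eqP.
rewrite {1}/mean (reindex_inj (inv_inj (flipK i))) -mulrDr -big_split big1 ?mulr0//.
move=> x _ /=; rewrite Fi ffunE eqxx.
by case: (x i); rewrite /= ?mulN1r ?mul1r ?addrN ?addNr.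
Qed.

Lemma wsum_flip i c x : (forall S, i \in S -> c S = 0) ->
  wsum c (flip i x) = wsum c x.
Proof.
move=> c0; apply: eq_bigr => S _; have [/c0->|iS] := boolP (i \in S).
  by rewrite !mul0r.
congr (_ * _); apply: eq_bigr => j jS; rewrite ffunE.
by case: eqP => // ji; rewrite -ji jS in iS.
Qed.

(** The form f = x_i u + v, where by [wsum_flip] neither u nor v depends on x_i; it drives the
    induction in [bonami]. *)
Lemma wsum_split i c x : wsum c x =
  spin R (x i) * wsum (fun S => if i \in S then 0 else c (i |: S)) x
  + wsum (fun S => if i \in S then 0 else c S) x.
Proof.
rewrite {1}/wsum (bigID (fun S => i \in S))/=; congr (_ + _).
  rewrite sum_setU1 mulr_sumr big_mkcond; apply: eq_bigr => S _ /=.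
  case: ifPn => [iS|]; last by rewrite negbK => ->; rewrite mul0r mulr0.
  by rewrite (negPf iS) /walsh big_setU1//= mulrCA.
rewrite big_mkcond; apply: eq_bigr => S _ /=.
by case: ifPn => [/negPf->//|]; rewrite negbK => ->; rewrite mul0r.
Qed.

End Cube.

(** * Cauchy-Schwarz, hypercontractivity and comparison of moments *)

Lemma cauchy_schwarz (R : realFieldType) (I : finType) (P : pred I) (F G : I -> R) :
  (\sum_(i | P i) F i * G i) ^+ 2 <= (\sum_(i | P i) F i ^+ 2) * (\sum_(i | P i) G i ^+ 2).
Proof.
set A := \sum_(i | P i) F i ^+ 2; set B := \sum_(i | P i) F i * G i.
set D := \sum_(i | P i) G i ^+ 2.
have D0 : 0 <= D by apply: sumr_ge0 => i _; exact: sqr_ge0.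
have [D_eq0|Dneq0] := eqVneq D 0.
  have G0 i : P i -> G i = 0.
    move=> Pi; apply/eqP; rewrite -sqrf_eq0; move/eqP: D_eq0.
    by rewrite psumr_eq0 => [/allP/(_ i (mem_index_enum i))|j _]; rewrite ?Pi ?sqr_ge0.
  by rewrite /B big1 ?expr0n ?D_eq0 ?mulr0// => i /G0->; rewrite mulr0.
(* This sum of squares expands to D (A D - B^2), and D > 0 here. *)
have : 0 <= \sum_(i | P i) (D * F i - B * G i) ^+ 2.
  by apply: sumr_ge0 => i _; exact: sqr_ge0.
have expand (a b : R) : \sum_(i | P i) (a * F i - b * G i) ^+ 2 =
    a ^+ 2 * A - 2 * a * b * B + b ^+ 2 * D.
  rewrite /A /B /D !mulr_sumr -sumrB -big_split; apply: eq_bigr => i _ /=; ring.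
rewrite expand (_ : _ + _ = D * (A * D - B ^+ 2)); last by ring.
by rewrite pmulr_rge0 ?subr_ge0// lt_neqAle eq_sym Dneq0.
Qed.

Section Bonami.
Variables (R : realType) (n : nat).

Lemma mean_cauchy_schwarz (F G : cube n -> R) :
  mean (fun x => F x * G x) ^+ 2 <=
  mean (fun x => F x ^+ 2) * mean (fun x => G x ^+ 2).
Proof.
rewrite /mean exprMn [X in _ <= X]mulrACA -expr2.
by rewrite ler_wpM2l ?sqr_ge0//; exact: (cauchy_schwarz predT).
Qed.

(** Bonami's inequality, by induction on the number of active variables T. With f = x_i u + v the
    odd powers of x_i average out, so E f^4 = E u^4 + 6 E u^2 v^2 + E v^4. The degree of u drops by
    one, so its constant is 9 times smaller, which pays for the cross term. *)
Lemma bonami (d : nat) (T : {set 'I_n}) (c : {set 'I_n} -> R) :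
  (forall S, c S != 0 -> (S \subset T) && (#|S| <= d)%N) ->
  mean (fun x => wsum c x ^+ 4) <= 9 ^+ d * mean (fun x => wsum c x ^+ 2) ^+ 2.
Proof.
(* An empty T and degree 0 both leave a constant function. *)
have base (e : {set 'I_n} -> R) m : (forall S, e S != 0 -> S == finset.set0) ->
    mean (fun x => wsum e x ^+ 4) <= 9 ^+ m * mean (fun x => wsum e x ^+ 2) ^+ 2.
  move=> e0; have E x : wsum e x = e finset.set0.
    rewrite /wsum (bigD1 finset.set0)//= /walsh big_set0 mulr1 big1 ?addr0// => S S0.
    by have [->|/e0] := eqVneq (e S) 0; rewrite ?mul0r// (negPf S0).
  rewrite (eq_mean (fun x => congr1 (fun t => t ^+ 4) (E x))).
  rewrite (eq_mean (fun x => congr1 (fun t => t ^+ 2) (E x))) !mean_const -exprM.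
  by rewrite ler_peMl ?exprn_even_ge0// exprn_ege1// ler1n.
move Dm : #|T| => m; elim: m => [|m IH] in d T c Dm *.
  move=> cT; apply: base => S /cT; move/eqP: Dm; rewrite cards_eq0 => /eqP->.
  by rewrite finset.subset0 => /andP[].
move=> cT; case: d cT => [|d] cT.
  by apply: base => S /cT; rewrite leqn0 cards_eq0 => /andP[].
have [i iT] : exists i, i \in T by apply/set0Pn; rewrite -card_gt0 Dm.
pose c1 (S : {set 'I_n}) := if i \in S then 0 else c (i |: S).
pose c0 (S : {set 'I_n}) := if i \in S then 0 else c S.
have cardT : #|T :\ i| = m by apply: succn_inj; rewrite -Dm [in RHS](cardsD1 i) iT.
have H1 : mean (fun x => wsum c1 x ^+ 4) <= 9 ^+ d * mean (fun x => wsum c1 x ^+ 2) ^+ 2.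
  apply: (IH _ (T :\ i)) => // S; rewrite /c1; case: ifPn => [|iS /cT]; first by rewrite eqxx.
  rewrite cardsU1 iS ltnS => /andP[ST ->]; rewrite andbT finset.subsetD1 iS andbT.
  by apply: fintype.subset_trans ST; exact: finset.subsetU1.
have H0 : mean (fun x => wsum c0 x ^+ 4) <= 9 ^+ d.+1 * mean (fun x => wsum c0 x ^+ 2) ^+ 2.
  apply: (IH _ (T :\ i)) => // S; rewrite /c0; case: ifPn => [|iS /cT]; first by rewrite eqxx.
  by case/andP => ST ->; rewrite andbT finset.subsetD1 iS andbT.
pose u := wsum c1; pose v := wsum c0.
have ui x : u (flip i x) = u x by apply: wsum_flip => S; rewrite /c1 => ->.
have vi x : v (flip i x) = v x by apply: wsum_flip => S; rewrite /c0 => ->.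
set a := mean (fun x => wsum c1 x ^+ 2) in H1; set b := mean (fun x => wsum c0 x ^+ 2) in H0.
have E2 : mean (fun x => wsum c x ^+ 2) = a + b.
  transitivity (mean (fun x => (u x ^+ 2 + v x ^+ 2) + 2 * (spin R (x i) * (u x * v x)))).
    apply: eq_mean => x; rewrite (wsum_split i) -/c1 -/c0 -/(u x) -/(v x).
    transitivity ((spin R (x i) * spin R (x i)) * u x ^+ 2 + v x ^+ 2
      + 2 * (spin R (x i) * (u x * v x))); first by ring.
    by rewrite spin_sqr mul1r.
  by rewrite 2!meanD meanZ mean_spin_flip ?mulr0 ?addr0// => x; rewrite ui vi.
have E4 : mean (fun x => wsum c x ^+ 4) = mean (fun x => u x ^+ 4)
    + 6 * mean (fun x => u x ^+ 2 * v x ^+ 2) + mean (fun x => v x ^+ 4).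
  transitivity (mean (fun x => (u x ^+ 4 + 6 * (u x ^+ 2 * v x ^+ 2) + v x ^+ 4)
      + spin R (x i) * (4 * (u x ^+ 3 * v x + u x * v x ^+ 3)))).
    apply: eq_mean => x; rewrite (wsum_split i) -/c1 -/c0 -/(u x) -/(v x).
    set s := spin R (x i).
    transitivity ((s * s) * (s * s) * u x ^+ 4 + 6 * (s * s) * (u x ^+ 2 * v x ^+ 2)
      + v x ^+ 4 + s * (4 * ((s * s) * u x ^+ 3 * v x + u x * v x ^+ 3))); first by ring.
    by rewrite /s spin_sqr; ring.
  rewrite 3!meanD meanZ mean_spin_flip ?addr0// => x; rewrite ui vi//.
have X2 := mean_cauchy_schwarz (fun x => u x ^+ 2) (fun x => v x ^+ 2).
set X := mean _ in X2.
have a0 : 0 <= a by apply: mean_ge0 => x; exact: sqr_ge0.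
have b0 : 0 <= b by apply: mean_ge0 => x; exact: sqr_ge0.
have E0 : 0 <= (9 : R) ^+ d by exact: exprn_ge0.
(* The geometric mean of 9^d a^2 and 9^(d+1) b^2; six times it is exactly the mixed term of 9^(d+1)
   (a + b)^2. *)
have Xle : X <= 3 * 9 ^+ d * a * b.
  rewrite -(@ler_pXn2r _ 2)// ?nnegrE; last 2 first.
  - by apply: mean_ge0 => x; rewrite mulr_ge0 ?sqr_ge0.
  - by do !apply: mulr_ge0 => //; rewrite ler0n.
  apply: le_trans X2 _.
  under eq_mean do rewrite -exprM.
  under [X in _ * X]eq_mean do rewrite -exprM.
  apply: le_trans (ler_pM _ _ H1 H0) _; try by apply: mean_ge0 => x; rewrite exprn_even_ge0.
  by rewrite le_eqVlt; apply/orP; left; rewrite [9 ^+ d.+1]exprS; apply/eqP; ring.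
rewrite E4 E2 -/X.
apply: le_trans (lerD (lerD H1 (ler_wpM2l _ Xle)) H0) _; first exact: ler0n.
rewrite [9 ^+ d.+1]exprS -subr_ge0.
have -> : 9 * 9 ^+ d * (a + b) ^+ 2 - (9 ^+ d * a ^+ 2 + 6 * (3 * 9 ^+ d * a * b)
  + 9 * 9 ^+ d * b ^+ 2) = 8 * 9 ^+ d * a ^+ 2 by ring.
by do !apply: mulr_ge0 => //; rewrite ?ler0n ?sqr_ge0.
Qed.

(* g^2 <= l |g| + g^4 / l^2 pointwise, with l^2 = 2 * 9^d * E g^2. *)
Lemma mean_sqr_le_mean_norm (d : nat) (c : {set 'I_n} -> R) :
  (forall S, c S != 0 -> (#|S| <= d)%N) ->
  mean (fun x => wsum c x ^+ 2) <= (3 ^+ d.+1 * mean (fun x => `|wsum c x|)) ^+ 2.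
Proof.
move=> cd.
have B : mean (fun x => wsum c x ^+ 4) <= 9 ^+ d * mean (fun x => wsum c x ^+ 2) ^+ 2.
  by apply: (@bonami d [set: 'I_n]%SET) => S /cd ->; rewrite finset.subsetT.
set A := mean (fun x => wsum c x ^+ 2) in B *; set L := mean (fun x => `|_|).
have A0 : 0 <= A by apply: mean_ge0 => x; exact: sqr_ge0.
have [->|An0] := eqVneq A 0; first exact: sqr_ge0.
have Ap : 0 < A by rewrite lt_neqAle eq_sym An0.
have D0 : 0 < (9 : R) ^+ d by exact: exprn_gt0.
have D1 : 0 < 2 * 9 ^+ d * A by do !apply: mulr_gt0 => //; rewrite ltr0n.
pose l := Num.sqrt (2 * 9 ^+ d * A).
have l2 : l ^+ 2 = 2 * 9 ^+ d * A by rewrite sqr_sqrtr// ltW.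
have l0 : 0 < l by rewrite sqrtr_gt0.
have L0 : 0 <= L by apply: mean_ge0.
have pt y : 0 <= y -> y ^+ 2 <= l * y + (l ^+ 2)^-1 * y ^+ 4.
  move=> y0; have r0 : 0 <= (l ^+ 2)^-1 * y ^+ 4.
    by rewrite mulr_ge0// ?invr_ge0 exprn_ge0// ltW.
  have [yl|/ltW ly] := leP y l; first by rewrite ler_wpDr// expr2 ler_wpM2r.
  apply: ler_wpDl; first by rewrite mulr_ge0// ltW.
  rewrite ler_pdivlMl ?exprn_gt0// [y ^+ 4](exprD y 2 2).
  by rewrite ler_wpM2r ?sqr_ge0// lerXn2r ?nnegrE// ltW.
have AL : A <= l * L + (l ^+ 2)^-1 * mean (fun x => wsum c x ^+ 4).
  rewrite /L -!meanZ -meanD; apply: mean_le => x; set g := wsum c x.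
  have := pt `|g| (normr_ge0 _).
  by rewrite -!normrX (ger0_norm (sqr_ge0 g)) (@ger0_norm _ (g ^+ 4)) ?exprn_even_ge0.
have A2 : A <= 2 * l * L.
  (* By the choice of [l] the fourth-moment term is absorbed in the left side. Squaring then gives A
     <= 8 9^d L^2, and 8 is rounded up to 9. *)
  have h : (l ^+ 2)^-1 * mean (fun x => wsum c x ^+ 4) <= A / 2.
    have -> : A / 2 = (l ^+ 2)^-1 * (9 ^+ d * A ^+ 2).
      by rewrite l2; field; rewrite !gt_eqF.
    by rewrite ler_pM2l ?invr_gt0 ?exprn_gt0.
  by move: (le_trans AL (lerD (lexx _) h)); set t := l * L; rewrite -mulrA -/t; lra.
have lL0 : 0 <= 2 * l * L by rewrite mulr_ge0// ltW// mulr_gt0// ltr0n.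
have : A * A <= A * (8 * 9 ^+ d * L ^+ 2).
  have -> : A * (8 * 9 ^+ d * L ^+ 2) = (2 * l * L) * (2 * l * L).
    by transitivity (4 * l ^+ 2 * L ^+ 2); [rewrite l2; ring|ring].
  by rewrite ler_pM.
rewrite ler_pM2l// => h; apply: le_trans h _.
have -> : (3 ^+ d.+1 * L) ^+ 2 = 9 ^+ d.+1 * L ^+ 2.
  by rewrite [LHS]exprMn [X in X * _]exprAC (_ : 3 ^+ 2 = 9)//; ring.
by rewrite [9 ^+ d.+1]exprS ler_wpM2r ?sqr_ge0// ler_wpM2r ?ler_nat// ltW.
Qed.

End Bonami.

(** * Multilinear extension, gradient and influences *)

Section Gradient.
Variables (R : realType) (n : nat).
Implicit Types (c : {set 'I_n} -> R) (v : 'I_n -> R).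

Definition multilinear c v : R := \sum_(S : {set 'I_n}) c S * \prod_(i in S) v i.

(** For |v_i| <= 1 the weights form the product probability measure on the cube with coordinate
    means v_i; under it w_S has mean prod_(i in S) v_i by independence. *)
Lemma multilinear_avg c v : multilinear c v =
  \sum_(x : cube n) (\prod_i ((1 + spin R (x i) * v i) / 2)) * wsum c x.
Proof.
under [RHS]eq_bigr do rewrite /wsum mulr_sumr.
rewrite exchange_big; apply: eq_bigr => S _ /=.
under [RHS]eq_bigr do rewrite mulrCA walshE -big_split/=.
rewrite -mulr_sumr (sum_cube_prod (fun i b => (1 + spin R b * v i) / 2 *
  (if i \in S then spin R b else 1))); congr (_ * _).
rewrite big_mkcond; apply: eq_bigr => i _ /=.
by case: ifP => _; field.
Qed.

Lemma multilinear_bound c v (M : R) : (forall x, `|wsum c x| <= M) ->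
  (forall i, `|v i| <= 1) -> `|multilinear c v| <= M.
Proof.
move=> cM v1; rewrite multilinear_avg; apply: le_trans (ler_norm_sum _ _ _) _.
have w0 (x : cube n) : 0 <= \prod_i ((1 + spin R (x i) * v i) / 2).
  apply: prodr_ge0 => i _; rewrite divr_ge0 ?ler0n//.
  have := v1 i; rewrite ler_norml => /andP[]; rewrite /spin.
  by case: (x i); lra.
have -> : M = \sum_(x : cube n) (\prod_i ((1 + spin R (x i) * v i) / 2)) * M.
  rewrite -mulr_suml (sum_cube_prod (fun i b => (1 + spin R b * v i) / 2)).
  by rewrite big1 ?mul1r// => i _; rewrite /spin; field.
by apply: ler_sum => x _; rewrite normrM ger0_norm// ler_wpM2l.
Qed.

(** The coefficient of t^j in the extension at t x is the level-j part at x. [markov_coef] bounds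
    each, and d + 1 of them are added. *)
Lemma low_part_bound (d k : nat) c (M : R) : (0 < k)%N ->
  (forall S : {set 'I_n}, (k < #|S|)%N -> c S = 0) -> (forall x, `|wsum c x| <= M) ->
  forall x, `|wsum (fun S => if (#|S| <= d)%N then c S else 0) x|
    <= d.+1%:R * ((5 * 2 ^+ d * k%:R) ^+ d * M).
Proof.
move=> k0 ck cM x.
pose p : {poly R} := \sum_(S : {set 'I_n}) (c S * walsh R S x) *: 'X^#|S|.
have sp : (size p <= k.+1)%N.
  apply: leq_trans (size_sum _ _ _) _; apply/bigmax_leqP => S _.
  have [Sk|/ck->] := leqP #|S| k; last by rewrite mul0r scale0r size_poly0.
  by rewrite (leq_trans (size_scale_leq _ _))// size_polyXn.
have pM t : `|t| <= 1 -> `|p.[t]| <= M.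
  move=> t1; have -> : p.[t] = multilinear c (fun i => spin R (x i) * t).
    rewrite horner_sum; apply: eq_bigr => S _.
    by rewrite hornerZ hornerXn -mulrA big_split/= prodr_const.
  apply: multilinear_bound => // i.
  by rewrite normrM /spin; case: (x i); rewrite ?normrN normr1 mul1r.
have coefp_sum j : p`_j = \sum_(S : {set 'I_n}) (c S * walsh R S x) * (#|S| == j)%:R.
  by rewrite coef_sum; apply: eq_bigr => S _; rewrite coefZ coefXn eq_sym.
have -> : wsum (fun S => if (#|S| <= d)%N then c S else 0) x = \sum_(j < d.+1) p`_j.
  under [RHS]eq_bigr do rewrite coefp_sum.
  rewrite exchange_big; apply: eq_bigr => S _ /=; rewrite -mulr_sumr.
  case: leqP => Sd.
    rewrite (bigD1 (Ordinal (Sd : #|S| < d.+1)%N))//= eqxx big1 ?addr0 ?mulr1// => j.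
    by apply: contraNeq; rewrite pnatr_eq0 eqb0 negbK -val_eqE/= eq_sym.
  rewrite mul0r big1 ?mulr0// => j _; apply/eqP; rewrite pnatr_eq0 eqb0.
  by apply: contraTneq Sd => ->; rewrite -leqNgt -ltnS.
apply: le_trans (ler_norm_sum _ _ _) _.
rewrite mulr_natl -[X in _ *+ X](card_ord d.+1) -sumr_const; apply: ler_sum => j _.
by apply: (markov_coef k0 sp pM); rewrite -ltnS.
Qed.

(** The product rule at t = 0 along the line a + t b. *)
Lemma coef01_prod_linear (S : {set 'I_n}) (a b : 'I_n -> R) :
  let p := \prod_(i in S) ((a i)%:P + b i *: 'X) in
  p`_0 = \prod_(i in S) a i /\
  p`_1 = \sum_(i in S) b i * \prod_(l in S :\ i) a l.
Proof.
rewrite /=; split.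
  rewrite coef0_prod; apply: eq_bigr => i _.
  by rewrite coefD coefC coefZ coefX/= mulr0 addr0.
move Dm : #|S| => m; elim: m S Dm => [|m IH] S Dm.
  by move/eqP: Dm; rewrite cards_eq0 => /eqP->; rewrite !big_set0 coef1.
have [i iS] : exists i, i \in S by apply/finset.set0Pn; rewrite -card_gt0 Dm.
have Dm' : #|S :\ i| = m by apply: succn_inj; rewrite -Dm [in RHS](cardsD1 i) iS.
rewrite (big_setD1 i iS)/= [RHS](big_setD1 i iS)/= mulrDl coefD coefCM -scalerAl coefZ coefXM/=.
rewrite IH// coef0_prod [RHS]addrC; congr (_ + _); last first.
  congr (_ * _); apply: eq_bigr => l _.
  by rewrite coefD coefC coefZ coefX/= mulr0 addr0.
rewrite mulr_sumr; apply: eq_bigr => j; rewrite !inE => /andP[ji jS].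
rewrite mulrCA; congr (_ * _); rewrite [RHS](big_setD1 i)/=; last first.
  by rewrite !inE iS eq_sym ji.
congr (_ * _); apply: eq_bigl => l; rewrite !inE.
by rewrite andbCA.
Qed.

(** Fourier coefficients of x |-> (d_i F)(x/2), F the multilinear extension of c; halving the
    variables produces 2^-|S|. *)
Definition half_deriv (i : 'I_n) c (S : {set 'I_n}) : R :=
  if i \in S then 0 else c (i |: S) * 2 ^- #|S|.

(* Differentiating t |-> F((x + t y)/2) at 0, F the multilinear extension and
   y the sign vector of its gradient at x/2. *)
Lemma gradient_bound (d : nat) c (M : R) :
  (forall S : {set 'I_n}, (d < #|S|)%N -> c S = 0) -> (forall x, `|wsum c x| <= M) ->
  forall x, \sum_i `|wsum (half_deriv i c) x| <= 10 * d%:R * M.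
Proof.
move=> cd cM x; pose y i : R := Num.sg (wsum (half_deriv i c) x).
pose L i : {poly R} := (spin R (x i) / 2)%:P + (y i / 2) *: 'X.
pose p : {poly R} := \sum_(S : {set 'I_n}) c S *: \prod_(i in S) L i.
have sL i : (size (L i) <= 2)%N.
  rewrite (leq_trans (size_polyD _ _))// geq_max.
  rewrite (leq_trans (size_polyC_leq1 _))// (leq_trans (size_scale_leq _ _))//.
  by rewrite size_polyX.
have sp : (size p <= d.+1)%N.
  apply: leq_trans (size_sum _ _ _) _; apply/bigmax_leqP => S _.
  have [Sd|/cd->] := leqP #|S| d; last by rewrite scale0r size_poly0.
  rewrite (leq_trans (size_scale_leq _ _))// (leq_trans (size_poly_prod_leq _ _))//.
  rewrite leq_subLR; apply: leq_trans (_ : (\sum_(i in S) 2).+1 <= _)%N.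
    by rewrite ltnS leq_sum.
  by rewrite sum_nat_const muln2 -addnn -addnS leq_add2l.
have pM t : `|t| <= 1 -> `|p.[t]| <= M.
  move=> t1; have -> : p.[t] = multilinear c (fun i => spin R (x i) / 2 + y i / 2 * t).
    rewrite horner_sum; apply: eq_bigr => S _; rewrite hornerZ horner_prod.
    by congr (_ * _); apply: eq_bigr => i _; rewrite !hornerE.
  (* The halving keeps (x + t y)/2 in the solid cube for |t| <= 1. *)
  apply: multilinear_bound => // i; apply: le_trans (ler_normD _ _) _.
  rewrite [X in _ <= X](_ : 1 = 1 / 2 + 1 / 2 * 1); last by field.
  have s1 : `|spin R (x i)| = 1 by rewrite /spin; case: (x i); rewrite ?normrN normr1.
  have y1 : `|y i| <= 1 by rewrite normr_sg; case: eqP; rewrite //= ?ler01.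
  have h2 : `|2^-1 : R| = 2^-1 by rewrite ger0_norm ?invr_ge0 ?ler0n.
  rewrite !normrM s1 h2 lerD//.
  by rewrite ler_pM ?mulr_ge0 ?invr_ge0 ?ler0n// ler_wpM2r ?invr_ge0 ?ler0n.
have := markov_coef1 sp pM.
(* Grouped by i, the terms are y_i times the i-th derivative at x/2, whose sign is y_i. The factor
   1/2 turns 5 into 10. *)
have -> : p`_1 = 2^-1 * \sum_i `|wsum (half_deriv i c) x|.
  rewrite coef_sum mulr_sumr.
  transitivity (\sum_(S : {set 'I_n}) \sum_(i in S)
      c S * (y i / 2 * \prod_(l in S :\ i) (spin R (x l) / 2))).
    apply: eq_bigr => S _; rewrite coefZ -mulr_sumr; congr (_ * _).
    exact: (coef01_prod_linear S (fun i => spin R (x i) / 2) (fun i => y i / 2)).2.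
  rewrite (exchange_big_dep predT)//=; apply: eq_bigr => i _.
  rewrite sum_setU1 [`|_|]normrEsg mulrA [2^-1 * _]mulrC mulr_sumr big_mkcond.
  apply: eq_bigr => S _; rewrite /half_deriv; case: ifPn => [iS|]; last first.
    by rewrite negbK => ->; rewrite mul0r mulr0.
  rewrite (negPf iS) finset.setU1K// big_split/= prodr_const -/(walsh R S x) exprVn /y.
  by ring.
rewrite normrM ger0_norm ?invr_ge0 ?ler0n// ger0_norm ?sumr_ge0// mulrC ler_pdivrMr ?ltr0n//.
by move=> h; apply: le_trans h _; rewrite le_eqVlt; apply/orP; left; apply/eqP; ring.
Qed.

(** By Parseval the weights 2^-|S| >= 2^-d of [half_deriv] cost 2^d in L_2, and passing from L_2 to
    L_1 costs 3^(d+1). *)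
Lemma influence_le (d : nat) (i : 'I_n) c :
  (forall S : {set 'I_n}, (d < #|S|)%N -> c S = 0) ->
  Num.sqrt (\sum_(S : {set 'I_n} | i \in S) c S ^+ 2)
    <= 2 ^+ d * 3 ^+ d.+1 * mean (fun x => `|wsum (half_deriv i c) x|).
Proof.
move=> cd; have m0 : 0 <= mean (fun x : cube n => `|wsum (half_deriv i c) x|).
  by apply: mean_ge0 => x.
rewrite -(@ler_pXn2r _ 2)// ?nnegrE ?sqrtr_ge0//; last first.
  by rewrite mulr_ge0// mulr_ge0// exprn_ge0// ler0n.
rewrite sqr_sqrtr; last by apply: sumr_ge0 => S _; exact: sqr_ge0.
rewrite -mulrA [X in _ <= X]exprMn.
have dd S : half_deriv i c S != 0 -> (#|S| <= d)%N.
  rewrite /half_deriv; case: ifPn => [|iS]; first by rewrite eqxx.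
  apply: contraR; rewrite -ltnNge => dS.
  by rewrite cd ?mul0r// cardsU1 iS (leq_trans dS)// leq_addl.
apply: le_trans (ler_wpM2l (sqr_ge0 _) (mean_sqr_le_mean_norm dd)).
under eq_mean do rewrite expr2.
rewrite mean_wsumM mulr_sumr sum_setU1 big_mkcond; apply: ler_sum => S _.
rewrite -expr2 -exprMn; case: ifPn => [iS|]; last by rewrite sqr_ge0.
rewrite /half_deriv (negPf iS) mulrCA exprMn.
have [->|cS] := eqVneq (c (i |: S)) 0; first by rewrite expr0n/= mul0r.
rewrite ler_peMr ?sqr_ge0// exprn_ege1//.
have Sd : (#|S| <= d)%N.
  by apply: dd; rewrite /half_deriv (negPf iS) mulf_neq0// invr_neq0// expf_neq0// pnatr_eq0.
by rewrite ler_pdivlMr ?exprn_gt0// mul1r ler_weXn2l// ler1n.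
Qed.

(** Product of the constants of [influence_le], [gradient_bound] and [low_part_bound], with k^d left
    out. *)
Definition influence_const (d : nat) : R :=
  2 ^+ d * 3 ^+ d.+1 * (10 * d%:R * (d.+1%:R * (5 * 2 ^+ d) ^+ d)).

(** Truncation to levels at most d comes first, so that the gradient and moment estimates cost
    constants in d only and k enters through [low_part_bound] alone. *)
Lemma low_influence_bound (d k : nat) c : (0 < k)%N ->
  (forall S : {set 'I_n}, (k < #|S|)%N -> c S = 0) -> (forall x, `|wsum c x| <= 1) ->
  \sum_i Num.sqrt (\sum_(S : {set 'I_n} | (i \in S) && (#|S| <= d)%N) c S ^+ 2)
    <= influence_const d * k%:R ^+ d.
Proof.
move=> k0 ck c1; pose e (S : {set 'I_n}) := if (#|S| <= d)%N then c S else 0.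
have ed (S : {set 'I_n}) : (d < #|S|)%N -> e S = 0 by move=> dS; rewrite /e leqNgt dS.
have eM := low_part_bound d k0 ck c1; rewrite -/e in eM.
have gM := gradient_bound ed eM.
apply: le_trans (_ : \sum_i 2 ^+ d * 3 ^+ d.+1 * mean (fun x => `|wsum (half_deriv i e) x|) <= _).
  apply: ler_sum => i _; apply: le_trans (influence_le i ed).
  rewrite ler_wsqrtr// le_eqVlt; apply/orP; left; apply/eqP.
  rewrite big_mkcondr; apply: eq_bigr => S _; rewrite /e.
  by case: ifP; rewrite // expr0n.
rewrite -mulr_sumr /influence_const -!mulrA ler_wpM2l ?exprn_ge0 ?ler0n//.
rewrite ler_wpM2l ?exprn_ge0 ?ler0n//.
have -> : \sum_i mean (fun x => `|wsum (half_deriv i e) x|) =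
    mean (fun x => \sum_i `|wsum (half_deriv i e) x|).
  by rewrite /mean -mulr_sumr exchange_big.
apply: le_trans (mean_le gM) _; rewrite mean_const mulr1 exprMn le_eqVlt.
by apply/orP; left; apply/eqP; rewrite -!exprMn !mulrA; ring.
Qed.

End Gradient.

(** * Pairing Fourier coefficients with a vector in l_q *)

(** Each of A, c^2 / b and b^d is at most their sum X, so (|a| |c|)^(2d) <= A^(d-1) (X b)^d <=
    X^(2d). Integer powers in the hypothesis on a also cover d = 1, where it amounts to |a| <= 1. *)
Lemma mul_le_threeterm (R : realFieldType) (d : nat) (a c A b : R) : (0 < d)%N ->
  0 <= A -> 0 < b -> `|a| ^+ (2 * d) <= A ^+ d.-1 ->
  `|a| * `|c| <= A + c ^+ 2 / b + b ^+ d.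
Proof.
move=> d0 A0 b0 aA; set X := A + _ + _.
have c0 : 0 <= c ^+ 2 / b by rewrite divr_ge0 ?sqr_ge0// ltW.
have bd : 0 <= b ^+ d by rewrite exprn_ge0// ltW.
have X0 : 0 <= X by rewrite !addr_ge0.
have AX : A <= X by rewrite /X -addrA lerDl addr_ge0.
have cX : c ^+ 2 <= X * b by rewrite -ler_pdivrMr// /X addrAC lerDr addr_ge0.
have bX : b ^+ d <= X by rewrite /X lerDr addr_ge0.
have dd : (0 < 2 * d)%N by rewrite muln_gt0.
rewrite -(@ler_pXn2r _ (2 * d))// ?nnegrE ?mulr_ge0// exprMn.
have c2d : `|c| ^+ (2 * d) <= X ^+ d * b ^+ d.
  rewrite exprM real_normK ?num_real// -exprMn lerXn2r ?nnegrE ?sqr_ge0//.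
  by rewrite mulr_ge0// ltW.
have A2 : A ^+ d.-1 <= X ^+ d.-1 by rewrite lerXn2r ?nnegrE.
apply: le_trans (_ : _ <= X ^+ d.-1 * (X ^+ d * X)) _.
  rewrite ler_pM ?exprn_ge0//; first exact: le_trans A2.
  by apply: le_trans c2d _; rewrite ler_wpM2l// exprn_ge0.
by rewrite -exprSr -exprD addnS -addSn prednK// addnn mul2n.
Qed.

Section Pairing.
Variables (R : realType) (n d : nat).
Hypothesis d0 : (0 < d)%N.
Implicit Types (a c A : {set 'I_n} -> R) (b : 'I_n -> R).

(** The left side is prod_i (1 + b_i), and 1 + b <= e^b. *)
Lemma sum_prod_le_expR b : (forall i, 0 <= b i) ->
  \sum_(S : {set 'I_n}) \prod_(i in S) b i <= expR (\sum_i b i).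
Proof.
move=> b0; have -> : \sum_(S : {set 'I_n}) \prod_(i in S) b i = \prod_i (b i + 1).
  rewrite bigA_distr; apply: eq_big => [S|S _]; first by rewrite inE.
  by rewrite big_mkcond.
rewrite expR_sum; apply: ler_prod => i _.
by rewrite addr_ge0//= addrC expR_ge1Dx.
Qed.

(* With beta the least b i over i in S, one has |c| |a| <= A + c^2/beta + beta^d,
   while beta^d <= prod_(i in S) b i and 1/beta <= sum_(i in S) 1/b i. *)
Lemma pairing_term a c A b (S : {set 'I_n}) : (#|S| <= d)%N ->
  0 <= A S -> `|a S| ^+ (2 * d) <= A S ^+ d.-1 ->
  (forall i, 0 <= b i <= 1) -> (forall i, i \in S -> c S ^+ 2 <= b i ^+ 2) ->
  (S == finset.set0 -> `|c S| <= 1) ->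
  `|a S| * `|c S| <= A S + (\sum_(i in S) c S ^+ 2 / b i + (S == finset.set0)%:R)
    + \prod_(i in S) b i.
Proof.
move=> Sd A0 aA b01 cb c1; have [S0|Sn0] := eqVneq S finset.set0.
  subst S; rewrite !big_set0 add0r.
  (* With no i in S, beta = 1 is used: beta^d matches the empty product, and c^2 <= 1 is covered by
     the indicator of the empty set. *)
  apply: le_trans (mul_le_threeterm (c finset.set0) d0 A0 ltr01 aA) _.
  rewrite !expr1n divr1 lerD2r lerD2l -real_normK ?num_real//.
  by rewrite exprn_ile1// c1.
have [i0 i0S] := finset.set0Pn _ Sn0.
case: (arg_minP b i0S) => i iS imin.
have T0 : 0 <= \sum_(j in S) c S ^+ 2 / b j.
  by apply: sumr_ge0 => j _; rewrite divr_ge0 ?sqr_ge0//; case/andP: (b01 j).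
have P0 : 0 <= \prod_(j in S) b j by apply: prodr_ge0 => j _; case/andP: (b01 j).
have /andP[bi0 bi1] := b01 i; rewrite addr0.
(* If the least b_i is 0, then c_S = 0 and the left side vanishes. *)
have [bi|bin0] := eqVneq (b i) 0.
  have : c S ^+ 2 <= 0 by rewrite (le_trans (cb i iS))// bi expr0n.
  move=> h; rewrite -real_normK ?num_real// in h.
  have c_eq0 : `|c S| = 0 by apply/eqP; rewrite -sqrf_eq0 eq_le h sqr_ge0.
  by rewrite c_eq0 mulr0; exact: addr_ge0 (addr_ge0 A0 T0) P0.
have bip : 0 < b i by rewrite lt_neqAle eq_sym bin0.
apply: le_trans (mul_le_threeterm (c S) d0 A0 bip aA) _.
apply: lerD; first rewrite lerD2l (bigD1 i iS)/= lerDl.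
  by apply: sumr_ge0 => j _; rewrite divr_ge0 ?sqr_ge0//; case/andP: (b01 j).
apply: le_trans (_ : b i ^+ #|S| <= _); first exact: ler_wiXn2l.
by rewrite -prodr_const; apply: ler_prod => j jS; rewrite bi0 imin.
Qed.

(** The constant collects 1 from the sum of A, 1 from sum_i (1/b_i) sum_(S containing i) c_S^2 <=
    sum_i b_i, 1 from the empty set, and [expR 1] from the products. *)
Lemma pairing_normalised a c A b :
  (forall S, 0 <= A S) -> \sum_(S : {set 'I_n} | (#|S| <= d)%N) A S <= 1 ->
  (forall S : {set 'I_n}, (#|S| <= d)%N -> `|a S| ^+ (2 * d) <= A S ^+ d.-1) ->
  (forall i, 0 <= b i) -> \sum_i b i <= 1 ->
  (forall i, \sum_(S : {set 'I_n} | (i \in S) && (#|S| <= d)%N) c S ^+ 2 <= b i ^+ 2) ->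
  `|c finset.set0| <= 1 ->
  \sum_(S : {set 'I_n} | (#|S| <= d)%N) `|a S| * `|c S| <= 3 + expR 1.
Proof.
move=> A0 A1 aA b0 b1 cb c1.
have b01 i : 0 <= b i <= 1.
  by rewrite b0 (le_trans _ b1)// (bigD1 i)//= lerDl sumr_ge0.
apply: le_trans (_ : \sum_(S : {set 'I_n} | (#|S| <= d)%N) (A S +
  (\sum_(i in S) c S ^+ 2 / b i + (S == finset.set0)%:R) + \prod_(i in S) b i) <= _).
  apply: ler_sum => S Sd; apply: pairing_term => // [|i iS|/eqP->//]; first exact: aA.
  apply: le_trans (cb i); rewrite (bigD1 S) ?iS//= lerDl sumr_ge0// => T _; exact: sqr_ge0.
rewrite 2!big_split/= lerD//; last first.
  apply: le_trans (_ : expR (\sum_i b i) <= _); last by rewrite ler_expR.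
  apply: le_trans (sum_prod_le_expR b0).
  rewrite [X in _ <= X](bigID (fun S : {set 'I_n} => (#|S| <= d)%N))/= lerDl.
  by apply: sumr_ge0 => S _; apply: prodr_ge0.
have -> : 3 = 1 + (1 + 1) :> R by ring.
rewrite lerD// big_split lerD//=.
  rewrite (exchange_big_dep predT)//=; apply: le_trans b1; apply: ler_sum => i _.
  rewrite -mulr_suml; under eq_bigl do rewrite andbC.
  (* At b_i = 0 the convention 1/0 = 0 makes the term vanish. *)
  have [->|bi] := eqVneq (b i) 0; first by rewrite invr0 mulr0.
  by rewrite ler_pdivrMr -?expr2// lt_neqAle eq_sym bi b0.
rewrite (bigD1 finset.set0) ?cards0//= eqxx big1 ?addr0// => S /andP[_ /negPf->].
by [].
Qed.

Lemma ellq_ge0 a : 0 <= ellq d a.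
Proof.
rewrite /ellq; case: ifP => _; last exact: powR_ge0.
by elim/big_ind: _ => // x y x0 y0; rewrite le_max x0.
Qed.

(* A is |a/N|^q, q = 2d/(d-1), when d > 1; for d = 1 only |a| <= N is needed. *)
Lemma ellq_witness a (N : R) : 0 < N -> ellq d a <= N ->
  exists A, [/\ forall S, 0 <= A S,
    \sum_(S : {set 'I_n} | (#|S| <= d)%N) A S <= 1 &
    forall S : {set 'I_n}, (#|S| <= d)%N -> `|a S / N| ^+ (2 * d) <= A S ^+ d.-1].
Proof.
move=> N0; rewrite /ellq; case: eqP => [d1|d1] aN.
  (* The exponent d - 1 is 0 here, and 0^0 = 1. *)
  exists (fun=> 0); split=> [S||S Sd]//; first by rewrite big1.
  rewrite d1 expr0 exprn_ile1// normrM (gtr0_norm (_ : 0 < N^-1)) ?invr_gt0//.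
  rewrite ler_pdivrMr// mul1r; apply: le_trans aN.
  by rewrite (bigD1 S)//= le_max lexx.
have d2 : 0 < d%:R - 1 :> R.
  by rewrite subr_gt0 ltr1n ltn_neqAle d0 andbT; apply/eqP/nesym.
pose q := qexp R d; have q0 : 0 < q by rewrite divr_gt0// mulr_gt0 ?ltr0n.
have qd : q * (d.-1)%:R = (2 * d)%:R.
  by rewrite -subn1 natrB// natrM /q /qexp divfK// gt_eqF.
exists (fun S => `|a S / N| `^ q); split=> [S||S Sd]; first exact: powR_ge0.
  set s := \sum_(S : {set 'I_n} | (#|S| <= d)%N) `|a S| `^ q in aN.
  have s0 : 0 <= s by apply: sumr_ge0 => S _; exact: powR_ge0.
  have -> : \sum_(S : {set 'I_n} | (#|S| <= d)%N) `|a S / N| `^ q = s * N^-1 `^ q.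
    rewrite /s mulr_suml; apply: eq_bigr => S _.
    by rewrite normrM (gtr0_norm (_ : 0 < N^-1)) ?invr_gt0// powRM// invr_ge0 ltW.
  have sN : s <= N `^ q.
    have -> : s = (s `^ q^-1) `^ q by rewrite -powRrM mulVf ?gt_eqF// powRr1.
    by apply: ge0_ler_powR => //; rewrite ?nnegrE ?powR_ge0// ltW.
  apply: le_trans (ler_wpM2r (powR_ge0 _ _) sN) _.
  by rewrite -powRM ?invr_ge0 ?(ltW N0)// divff ?gt_eqF// powR1.
by rewrite -powR_mulrn ?powR_ge0// -powRrM qd powR_mulrn.
Qed.

Lemma pairing_bound a c (M : R) : 0 < M -> `|c finset.set0| <= M ->
  \sum_i Num.sqrt (\sum_(S : {set 'I_n} | (i \in S) && (#|S| <= d)%N) c S ^+ 2) <= M ->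
  \sum_(S : {set 'I_n} | (#|S| <= d)%N) `|a S| * `|c S| <= (3 + expR 1) * M * ellq d a.
Proof.
move=> M0 c0 bM; set K := (3 + expR 1) * M.
have K0 : 0 < K by rewrite mulr_gt0// addr_gt0 ?expR_gt0// ltr0n.
(* The norm of a may be 0, so a is divided by some N > 0 slightly above it; an excess e / K in N
   raises the bound by e. *)
suff main N : 0 < N -> ellq d a <= N ->
    \sum_(S : {set 'I_n} | (#|S| <= d)%N) `|a S| * `|c S| <= K * N.
  apply/ler_addgt0Pr => e e0; have eK : 0 < e / K by rewrite divr_gt0.
  have := main (ellq d a + e / K); rewrite mulrDr [K * (e / K)]mulrC divfK ?gt_eqF//.
  by apply; rewrite ?ltr_wpDl ?ellq_ge0// lerDl ltW.
move=> N0 aN; have [A [A0 A1 aA]] := ellq_witness N0 aN.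
pose b i := Num.sqrt (\sum_(S : {set 'I_n} | (i \in S) && (#|S| <= d)%N) c S ^+ 2).
have sum0 i : 0 <= \sum_(S : {set 'I_n} | (i \in S) && (#|S| <= d)%N) c S ^+ 2.
  by apply: sumr_ge0 => S _; exact: sqr_ge0.
have := @pairing_normalised (fun S => a S / N) (fun S => c S / M) A (fun i => b i / M).
have -> : \sum_(S : {set 'I_n} | (#|S| <= d)%N) `|a S / N| * `|c S / M| =
    (\sum_(S : {set 'I_n} | (#|S| <= d)%N) `|a S| * `|c S|) / (N * M).
  rewrite mulr_suml; apply: eq_bigr => S _.
  by rewrite !normrM !normfV (gtr0_norm N0) (gtr0_norm M0) invfM; ring.
rewrite ler_pdivrMr ?mulr_gt0// => h; rewrite /K -mulrA [M * N]mulrC; apply: h => //.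
- by move=> i; rewrite divr_ge0 ?sqrtr_ge0// ltW.
- by rewrite -mulr_suml ler_pdivrMr// mul1r.
- move=> i; rewrite exprMn sqr_sqrtr// mulr_suml; apply: ler_sum => S _.
  by rewrite exprMn.
- by rewrite normrM normfV (gtr0_norm M0) ler_pdivrMr// mul1r.
Qed.

End Pairing.

(** * Hahn-Banach along finitely many directions *)

Section HahnBanach.
Variables (R : realType) (V : lmodType R).
Implicit Types (p q : V -> R) (u v e : V).

Definition sublinear p :=
  (forall u v, p (u + v) <= p u + p v) /\ (forall t u, 0 <= t -> p (t *: u) <= t * p u).

Lemma sublinear0 p : sublinear p -> p 0 = 0.
Proof.
move=> [pD pZ]; apply/eqP; rewrite eq_le; have := pZ 0 0 (lexx _).
by rewrite scale0r mul0r => ->; have := pD 0 0; rewrite addr0 lerDl.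
Qed.

Lemma sublinearZ p t u : sublinear p -> 0 <= t -> p (t *: u) = t * p u.
Proof.
move=> ps; rewrite le_eqVlt => /predU1P[<-|t0].
  by rewrite scale0r mul0r sublinear0.
apply/eqP; rewrite eq_le ps.2 ?(ltW t0)//=.
have ti0 : 0 <= t^-1 by rewrite invr_ge0 ltW.
have := ps.2 t^-1 (t *: u) ti0; rewrite scalerA mulVf ?gt_eqF// scale1r.
by rewrite ler_pdivlMl.
Qed.

Lemma sublinear_opp p u : sublinear p -> - p (- u) <= p u.
Proof.
by move=> ps; rewrite -subr_ge0 opprK -(sublinear0 ps) -{1}(subrr u) ps.1.
Qed.

Local Open Scope classical_set_scope.

(** For sublinear p, a sublinear functional below p whose value at -e is at most -p(e), hence linear
    along e. Tightening along a finite spanning family takes the place of Zorn's lemma. *)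
Definition tighten p e u : R := inf [set p (u + t *: e) - t * p e | t in [set t | 0 <= t]].

Lemma tighten_ge p e u (a : R) :
  (forall t, 0 <= t -> a <= p (u + t *: e) - t * p e) -> a <= tighten p e u.
Proof.
move=> h; apply: lb_le_inf.
  by exists (p (u + 0 *: e) - 0 * p e); exists 0 => /=.
by move=> _ [t /= t0 <-]; exact: h.
Qed.

Lemma tighten_le p e u t : sublinear p -> 0 <= t ->
  tighten p e u <= p (u + t *: e) - t * p e.
Proof.
move=> ps t0; apply: ge_inf; last by exists t.
(* Lower bound of the set: p(s e) <= p(u + s e) + p(-u). *)
exists (- p (- u)) => _ [s /= s0 <-]; rewrite lerBrDr addrC lerBlDr -sublinearZ//.
by apply: le_trans (ps.1 _ _); rewrite addrAC subrr add0r.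
Qed.

Lemma sublinear_tighten p e : sublinear p -> sublinear (tighten p e).
Proof.
move=> ps; split=> [u v|t u].
  rewrite -lerBlDr; apply: tighten_ge => t t0; rewrite lerBlDl -lerBlDr.
  apply: tighten_ge => s s0; rewrite lerBlDr.
  apply: le_trans (tighten_le _ _ ps (addr_ge0 s0 t0)) _.
  have -> : u + v + (s + t) *: e = (u + t *: e) + (v + s *: e).
    by rewrite addrACA -scalerDl [t + s]addrC.
  by have := ps.1 (u + t *: e) (v + s *: e); lra.
rewrite le_eqVlt => /predU1P[<-|t0].
  rewrite scale0r mul0r; apply: le_trans (tighten_le _ _ ps (lexx 0)) _.
  by rewrite scale0r addr0 mul0r subr0 sublinear0.
rewrite -ler_pdivrMl//; apply: tighten_ge => s s0; rewrite ler_pdivrMl//.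
apply: le_trans (tighten_le _ _ ps (mulr_ge0 (ltW t0) s0)) _.
by rewrite -scalerA -scalerDr sublinearZ ?(ltW t0)// mulrBr mulrA.
Qed.

Lemma tighten_le_self p e u : sublinear p -> tighten p e u <= p u.
Proof.
move=> ps; apply: le_trans (tighten_le _ _ ps (lexx 0)) _.
by rewrite scale0r addr0 mul0r subr0.
Qed.

Lemma tighten_opp p e : sublinear p -> tighten p e (- e) <= - p e.
Proof.
move=> ps; apply: le_trans (tighten_le _ _ ps ler01) _.
by rewrite scale1r addNr sublinear0// mul1r sub0r.
Qed.

(** Later tightenings only lower the functional, so q(-e) <= -p(e) <= -q(e) survives them. *)
Lemma sublinear_minorant p (es : seq V) : sublinear p ->
  exists q, [/\ sublinear q, forall u, q u <= p u & forall e, e \in es -> q (- e) <= - q e].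
Proof.
elim: es p => [|e es IH] p ps; first by exists p.
have [q [qs qp qe]] := IH _ (sublinear_tighten e ps).
exists q; split=> // [u|e'].
  exact: le_trans (qp u) (tighten_le_self _ _ ps).
rewrite inE => /predU1P[->|]; last exact: qe.
apply: le_trans (qp _) (le_trans (tighten_opp _ ps) _).
by rewrite lerN2; apply: le_trans (qp e) (tighten_le_self _ _ ps).
Qed.

(** Tightening along f first forces p(f) <= -q(-f) <= q(f). When [es] spans, the last clause makes q
    linear. *)
Lemma hahn_banach p (es : seq V) f : sublinear p ->
  exists q, [/\ sublinear q, forall u, q u <= p u, q f = p f &
    forall e, e \in es -> q (- e) <= - q e].
Proof.
move=> ps; have [q [qs qp qe]] := sublinear_minorant es (sublinear_tighten f ps).
have qp' u : q u <= p u := le_trans (qp u) (tighten_le_self _ _ ps).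
exists q; split=> //; apply/eqP; rewrite eq_le qp'/= -[p f]opprK.
apply: le_trans (sublinear_opp f qs); rewrite lerN2.
exact: le_trans (qp _) (tighten_opp _ ps).
Qed.

End HahnBanach.

(** * Duality for the L_1 distance to the high-frequency functions *)

Section Duality.
Variables (R : realType) (n k : nat).
Implicit Types (f g h : cube n -> R).
Local Open Scope classical_set_scope.

Lemma fhatE f S : fhat f S = mean (fun x => f x * walsh R S x). Proof. by []. Qed.

Lemma PgtD f g : Pgt k f -> Pgt k g -> Pgt k (fun x => f x + g x).
Proof.
move=> fP gP S Sk; rewrite fhatE; under eq_mean do rewrite mulrDl.
by rewrite meanD -!fhatE fP// gP// addr0.
Qed.

Lemma PgtZ (a : R) f : Pgt k f -> Pgt k (fun x => a * f x).
Proof.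
move=> fP S Sk; rewrite fhatE; under eq_mean do rewrite -mulrA.
by rewrite meanZ -fhatE fP// mulr0.
Qed.

Lemma Pgt0 : Pgt k (fun _ : cube n => 0 : R).
Proof. by move=> S _; rewrite fhatE; under eq_mean do rewrite mul0r; rewrite mean_const. Qed.

Lemma Pgt_walsh (S : {set 'I_n}) : (k < #|S|)%N -> Pgt k (walsh R S).
Proof.
move=> kS T Tk; rewrite /fhat walsh_ortho; case: eqP => [ST|_]; last by rewrite !mulr0.
by move: kS; rewrite ST ltnNge Tk.
Qed.

Lemma distPgt_le f g : Pgt k g -> distPgt k f <= mean (fun x => `|f x - g x|).
Proof.
move=> gP; apply: ge_inf; last by exists g.
by exists 0 => _ [g' _ <-]; apply: mean_ge0.
Qed.

Lemma distPgt_ge f (a : R) :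
  (forall g, Pgt k g -> a <= mean (fun x => `|f x - g x|)) -> a <= distPgt k f.
Proof.
move=> h; apply: lb_le_inf.
  by exists (L1norm (fun x => f x - 0)); exists (fun=> 0) => //; exact: Pgt0.
by move=> _ [g gP <-]; exact: h.
Qed.

Lemma sublinear_distPgt : sublinear (fun u : {ffun cube n -> R^o} => distPgt k u).
Proof.
split=> [u v|t u].
  rewrite -lerBlDr; apply: distPgt_ge => g gP; rewrite lerBlDl -lerBlDr.
  apply: distPgt_ge => g' gP'; rewrite lerBlDr.
  apply: le_trans (distPgt_le _ (PgtD gP gP')) _.
  rewrite -meanD; apply: mean_le => x; rewrite ffunE.
  by rewrite opprD addrACA [leRHS]addrC ler_normD.
rewrite le_eqVlt => /predU1P[<-|t0].
  rewrite mul0r; apply: le_trans (distPgt_le _ Pgt0) _.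
  by under eq_mean do rewrite ffunE scale0r subr0 normr0; rewrite mean_const.
rewrite -ler_pdivrMl//; apply: distPgt_ge => g gP; rewrite ler_pdivrMl//.
apply: le_trans (distPgt_le _ (PgtZ t gP)) _.
rewrite -meanZ; apply: mean_le => x; rewrite ffunE.
by rewrite -mulrBr normrM gtr0_norm.
Qed.

(** The function h is the density, for the uniform measure, of a linear functional dominated by the
    distance and equal to it at f. Testing on signed point masses gives |h| <= 1; testing on plus
    and minus w_S with |S| > k, at distance 0, kills the high coefficients. *)
Lemma distPgt_dual f : exists h,
  [/\ forall x, `|h x| <= 1, forall S : {set 'I_n}, (k < #|S|)%N -> fhat h S = 0 &
    distPgt k f = mean (fun x => f x * h x)].
Proof.
pose V := {ffun cube n -> R^o}; pose delta (x : cube n) : V := [ffun y => (y == x)%:R].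
have [q [qs qp qf qe]] := hahn_banach [seq delta x | x : cube n]
  ([ffun x => f x] : V) sublinear_distPgt.
pose h x := 2 ^+ n * q (delta x).
have deltaE (u : V) : u = \sum_x u x *: delta x.
  apply/ffunP => y; rewrite sum_ffunE (bigD1 y)//= !ffunE eqxx big1 ?addr0.
    by rewrite [RHS]mulr1.
  by move=> x xy; rewrite !ffunE eq_sym (negPf xy); exact: mulr0.
have qL (u : V) : q u <= mean (fun x => u x * h x).
  have -> : mean (fun x => u x * h x) = \sum_x u x * q (delta x).
    rewrite /mean mulr_sumr; apply: eq_bigr => x _.
    by rewrite /h (mulrCA (u x : R)) mulKf// gt_eqF// pow2n_gt0.
  rewrite {1}(deltaE u); elim/big_ind2: _ => [|a b a' b' ha hb|x _].
  - by rewrite sublinear0.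
  - exact: le_trans (qs.1 _ _) (lerD ha hb).
  have [u0|/ltW u0] := leP 0 (u x); first exact: qs.2.
  have qd : q (- delta x) <= - q (delta x) by apply: qe; apply: map_f; rewrite mem_enum.
  have u0' : 0 <= - u x by rewrite oppr_ge0.
  rewrite -[u x]opprK scaleNr -scalerN mulNr -mulrN.
  exact: le_trans (qs.2 _ _ u0') (ler_wpM2l u0' qd).
(* The reverse inequality is [qL] at -u, since -q(-u) <= q(u). *)
have qLE (u : V) : q u = mean (fun x => u x * h x).
  apply/eqP; rewrite eq_le qL/= -[mean _]opprK.
  apply: le_trans (sublinear_opp u qs); rewrite lerN2.
  suff <- : mean (fun x => (- u) x * h x) = - mean (fun x => u x * h x) by exact: qL.
  by rewrite -[RHS]mulN1r -meanZ; apply: eq_mean => x; rewrite ffunE mulNr mulN1r.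
have hdist f' : mean (fun x => f' x * h x) <= distPgt k f'.
  have := qp ([ffun x => f' x] : V); rewrite qLE.
  rewrite (_ : ([ffun x => f' x] : V) = f' :> (cube n -> R)); last first.
    by apply/funext => x; rewrite ffunE.
  by [].
exists h; split.
- move=> x; have key (s : R) : `|s| = 1 -> s * h x <= 1.
    move=> s1; have := hdist (fun y => s * (y == x)%:R).
    have -> : mean (fun y => s * (y == x)%:R * h y) = (2 ^+ n)^-1 * (s * h x).
      rewrite /mean (bigD1 x)//= eqxx mulr1 big1 ?addr0// => y /negPf->.
      by rewrite mulr0 mul0r.
    move=> hx; have := le_trans hx (distPgt_le _ Pgt0).
    have -> : mean (fun y => `|s * (y == x)%:R - 0|) = (2 ^+ n)^-1 * 1.
      rewrite /mean (bigD1 x)//= eqxx (mulr1 s) subr0 s1 big1 ?addr0// => y /negPf->.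
      by rewrite mulr0 subr0 normr0.
    by rewrite ler_pM2l ?invr_gt0 ?pow2n_gt0.
  rewrite ler_norml -[h x]mul1r lerNl -mulNr !key ?normrN ?normr1//.
- move=> S kS; have key (s : R) : s * fhat h S <= 0.
    have := hdist (fun x => s * walsh R S x).
    have -> : mean (fun x => s * walsh R S x * h x) = s * fhat h S.
      by rewrite fhatE -meanZ; apply: eq_mean => x; rewrite -mulrA [walsh _ _ _ * _]mulrC.
    move=> hS; apply: le_trans hS _.
    apply: le_trans (distPgt_le _ (PgtZ s (Pgt_walsh kS))) _.
    by under eq_mean do rewrite subrr normr0; rewrite mean_const.
  by apply/eqP; rewrite eq_le -oppr_le0 -[- _]mulN1r -{1}[fhat h S]mul1r !key.
- transitivity (q ([ffun x => f x] : V)).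
    rewrite qf; congr (distPgt k _); apply/funext => x; by rewrite ffunE.
  by rewrite qLE; apply: eq_mean => x; rewrite ffunE.
Qed.

End Duality.

(** * Assembly of duality, influence bound and pairing into the K-functional estimate *)

Theorem theorem1p3 (R : realType) (d : nat) (hd : (1 <= d)%N) :
  exists C : R, 0 < C /\
    forall (n k : nat), (d <= k)%N -> (k <= n)%N ->
    forall f : cube n -> R, deg_le f d ->
      distPgt k f <= Kfun d (fhat f) (C * k%:R ^+ d).
Proof.
(* Adding 1 makes [M] at least 1, so that it is positive and also dominates the coefficient of h at
   the empty set. *)
pose I : R := influence_const R d + 1.
have I1 : 1 <= I.
  by rewrite lerDr; do ![apply: ler0n | apply: exprn_ge0 | apply: mulr_ge0].
have I0 : 0 < I by exact: lt_le_trans ltr01 I1.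
exists ((3 + expR 1) * I); split; first by rewrite mulr_gt0// addr_gt0 ?expR_gt0// ltr0n.
move=> n k dk kn f fd; have k0 : (0 < k)%N := leq_trans hd dk.
have [h [h1 hk ->]] := distPgt_dual k f; pose c := fhat h.
have hE x : wsum c x = h x by exact: wsum_fhat.
have pair : mean (fun x => f x * h x) =
    \sum_(S : {set 'I_n} | (#|S| <= d)%N) fhat f S * c S.
  under eq_mean do rewrite -(wsum_fhat f) -(wsum_fhat h).
  rewrite mean_wsumM (bigID (fun S : {set 'I_n} => (#|S| <= d)%N))/= addrC big1 ?add0r//.
  by move=> S; rewrite -ltnNge => /fd->; rewrite mul0r.
have kd1 : 1 <= k%:R ^+ d :> R by rewrite exprn_ege1// ler1n.
pose M := I * k%:R ^+ d.
have M1 : 1 <= M by rewrite -[1]mulr1 ler_pM.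
have c0M : `|c finset.set0| <= M.
  apply: le_trans M1; rewrite /c fhatE; apply: le_trans (_ : mean (fun _ : cube n => 1) <= _).
    rewrite /mean normrM ger0_norm ?invr_ge0 ?exprn_ge0// ler_wpM2l ?invr_ge0 ?exprn_ge0//.
    apply: le_trans (ler_norm_sum _ _ _) _; apply: ler_sum => x _.
    by rewrite /walsh big_set0 mulr1.
  by rewrite mean_const.
have infl : \sum_i Num.sqrt (\sum_(S : {set 'I_n} | (i \in S) && (#|S| <= d)%N) c S ^+ 2) <= M.
  apply: le_trans (low_influence_bound d k0 hk _) _; first by move=> x; rewrite hE.
  by rewrite /M ler_wpM2r ?exprn_ge0// lerDl.
have M0 : 0 < M by exact: lt_le_trans ltr01 M1.
(* Bessel's inequality with |h| <= 1; it lets the l_2 part enter with constant 1. *)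
have c2 : \sum_(S : {set 'I_n} | (#|S| <= d)%N) c S ^+ 2 <= 1.
  apply: le_trans (_ : \sum_S c S * c S <= _).
    rewrite [X in _ <= X](bigID (fun S : {set 'I_n} => (#|S| <= d)%N))/=.
    by rewrite lerDl sumr_ge0// => S _; rewrite -expr2 sqr_ge0.
  rewrite -mean_wsumM -(mean_const n 1); apply: mean_le => x.
  by rewrite hE -expr2 -real_normK ?num_real// exprn_ile1.
rewrite pair; apply: lb_le_inf.
  (* The trivial splitting shows that the infimum is taken over a nonempty set. *)
  exists (ell2 d (fhat f) + (3 + expR 1) * I * k%:R ^+ d * ellq d (fun _ : {set 'I_n} => 0)).
  by exists (fhat f), (fun=> 0); split=> // S _; rewrite addr0.
move=> _ [a0 [a1 [fE ->]]].
have -> : \sum_(S : {set 'I_n} | (#|S| <= d)%N) fhat f S * c S =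
    \sum_(S : {set 'I_n} | (#|S| <= d)%N) a0 S * c S +
    \sum_(S : {set 'I_n} | (#|S| <= d)%N) a1 S * c S.
  by rewrite -big_split; apply: eq_bigr => S Sd; rewrite fE// mulrDl.
apply: lerD.
  have s0 : 0 <= \sum_(S : {set 'I_n} | (#|S| <= d)%N) a0 S ^+ 2.
    by apply: sumr_ge0 => S _; exact: sqr_ge0.
  apply: le_trans (ler_norm _) _; rewrite -sqrtr_sqr /ell2 ler_wsqrtr//.
  by apply: le_trans (cauchy_schwarz _ _ _) _; rewrite ler_piMr.
apply: le_trans (_ : \sum_(S : {set 'I_n} | (#|S| <= d)%N) `|a1 S| * `|c S| <= _).
  by apply: ler_sum => S _; rewrite -normrM ler_norm.
by rewrite -[_ * I * _]mulrA; exact: pairing_bound.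
Qed.
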